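(* Let $G$ be a connected graph of order at least $2$. If $\gamma_{tm}(G)=2$, then $\mathrm{diam}(G)\leq 3$.
   Context: All graphs are non-empty, finite, undirected and simple; $\mathrm{diam}(G)$ is the maximum distance between pairs of vertices of $G$. A total mixed dominating set of a graph $G=(V,E)$ with minimum degree at least $1$ is a set $S\subseteq V\cup E$ such that every element of $V\cup E$ (including those in $S$) is adjacent or incident to an element of $S$ (two vertices are adjacent if joined by an edge; two distinct edges are adjacent if they share an endpoint; a vertex and an edge are incident if the vertex is an endpoint of the edge; no element is adjacent or incident to itself). The total mixed domination number $\gamma_{tm}(G)$ is the minimum cardinality of a total mixed dominating set. *)

(* Defs.v *)
From mathcomp Require Import all_boot.

Set Implicit Arguments.
Unset Strict Implicit.
Unset Printing Implicit Defensive.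

(* A finite simple graph is a symmetric irreflexive adjacency
   relation e on a finite type T of vertices. *)
Section Graph.
Variables (T : finType) (e : rel T).

Definition edge_set : {set {set T}} :=
  [set A : {set T} | [exists x, exists y, e x y && (A == [set x; y])]].

Definition edge := {A : {set T} | A \in edge_set}.

Definition element := (T + edge)%type.

Definition adj_or_inc (a b : element) : bool :=
  match a, b with
  | inl x, inl y => e x y
  | inl x, inr A => x \in val A
  | inr A, inl x => x \in val A
  | inr A, inr B => (A != B) && (val A :&: val B != set0)
  end.

Definition total_mixed_dominating (S : {set element}) : bool :=
  [forall a, exists b in S, adj_or_inc a b].

(* When no vertex is isolated, the set of all elements is a total mixed
   dominating set, so this is the true minimum; otherwise the value has no
   meaning. *)
Definition gamma_tm : nat :=
  #|[arg min_(S < [set: element] | total_mixed_dominating S) #|S|]|.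

Definition has_path (k : nat) (x y : T) : bool :=
  [exists p : k.-tuple T, [&& path e x p, uniq (x :: p) & last x p == y]].

(* A path has fewer than #|T| edges; the default value #|T| is returned only
   when x and y are not connected. *)
Definition dist (x y : T) : nat :=
  \big[minn/#|T|]_(k < #|T| | has_path k x y) k.

Definition diam : nat := \max_(x : T) \max_(y : T) dist x y.

Definition connected : Prop := forall x y : T, connect e x y.

End Graph.

(* Main.v *)
Require Import Defs.
From mathcomp Require Import all_boot.

(** Each of the two elements of a minimum total mixed dominating set must be
    dominated, and nothing dominates itself; so the two elements dominate each
    other.  They are then two adjacent vertices, a vertex and an incident edge,
    or two edges with a common endpoint, and in each case the graph has an edge
    uv such that every vertex is equal or adjacent to u or to v
    ([dominating_pair_hub]).  A walk from any vertex to any other through uv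
    has length at most 3: one step to reach uv, one along it, one to leave it
    ([hub_walk]).

    The connectedness and the order at least 2 rule out isolated vertices, so
    that the set of all elements is total mixed dominating
    ([setT_dominating]) and [gamma_tm] really is the minimum. *)

Section Graph.
Variables (T : finType) (e : rel T).
Hypotheses (e_sym : symmetric e) (e_irr : irreflexive e).

Lemma edge_at (A : edge e) u : u \in val A ->
  exists2 v, e u v & val A = [set u; v].
Proof.
case: A => A /= HA uA; move: HA uA; rewrite inE.
case/existsP=> x /existsP[y /andP[exy /eqP->]].
rewrite !inE => /orP[] /eqP->; first by exists y.
by exists x; rewrite 1?e_sym // setUC.
Qed.

Lemma edge_inhabited (A : edge e) : exists u, u \in val A.
Proof.
case: A => A /=; rewrite inE => /existsP[x /existsP[y /andP[_ /eqP->]]].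
by exists x; rewrite !inE eqxx.
Qed.

Lemma adj_or_inc_irr (a : element e) : adj_or_inc a a = false.
Proof. by case: a => [x|A] /=; [apply: e_irr | rewrite eqxx]. Qed.

Definition near x y := (x == y) || e x y.

Lemma near_walk x y : near x y ->
  exists p, [/\ path e x p, last x p = y & size p <= 1].
Proof.
by case/orP=> [/eqP->|exy]; [exists [::] | exists [:: y]; rewrite /= exy].
Qed.

Lemma near_sym x y : near x y = near y x.
Proof. by rewrite /near eq_sym e_sym. Qed.

Definition hub u v := e u v /\ forall x, near x u || near x v.

Lemma dominating_pair_hub (a b : element e) :
    adj_or_inc a b -> total_mixed_dominating [set a; b] ->
  exists u v, hub u v.
Proof.
move=> ab /forallP dom.
have {}dom x : adj_or_inc (inl x) a || adj_or_inc (inl x) b.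
  by case/exists_inP: (dom (inl x)) => c; rewrite !inE => /orP[] /eqP-> ->;
    rewrite ?orbT.
(* The case of a vertex u and an incident edge uv, stated apart because the
   pair may come in either order. *)
have mixed u (A : edge e) : u \in val A ->
    (forall x, e x u || (x \in val A)) -> exists v, hub u v.
  case/edge_at=> v euv -> domu; exists v; split=> // x; rewrite /near.
  by case/orP: (domu x) => [->|]; rewrite ?orbT // !inE => /orP[] ->;
    rewrite ?orbT.
case: a b ab dom => [u|A] [v|B] /= ab dom.
- by exists u, v; split=> // x; rewrite /near; case/orP: (dom x) => ->;
    rewrite !orbT.
- by exists u; apply: mixed ab dom.
- by exists v; apply: mixed ab _ => x; rewrite orbC.
- case/andP: ab => _ /set0Pn[u]; rewrite inE => /andP[uA uB].
  case/edge_at: uA dom => v euv ->; case/edge_at: uB => w euw -> dom.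
  (* Either edge serves: the far end w of the other one is adjacent to u. *)
  exists u, v; split=> // x; rewrite /near.
  case/orP: (dom x); rewrite !inE => /orP[] /eqP->;
    by rewrite ?eqxx ?orbT // [e w u]e_sym euw !orbT.
Qed.

Lemma hub_walk u v x y : hub u v ->
  exists p, [/\ path e x p, last x p = y & size p <= 3].
Proof.
case=> euv hubP.
have anchor z : exists2 c, c \in [:: u; v] & near z c.
  by case/orP: (hubP z) => zc; [exists u | exists v]; rewrite ?inE ?eqxx ?orbT.
have [c cuv /near_walk[p [xp lp sp]]] := anchor x; rewrite -{c}lp in cuv.
have [d duv] := anchor y; rewrite near_sym => /near_walk[r [dr <- sr]].
have /near_walk[q [cq lq sq]] : near (last x p) d.
  move: cuv duv; rewrite /near !inE => /orP[] /eqP-> /orP[] /eqP->;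
    by rewrite ?eqxx // 1?[e v u]e_sym euv orbT.
exists (p ++ q ++ r); rewrite !cat_path !last_cat lq xp cq dr !size_cat.
by split=> //; rewrite (leq_add sp (leq_add sq sr)).
Qed.

Lemma bigmin_leq n m (P : pred 'I_n) (k : 'I_n) :
  P k -> \big[minn/m]_(i < n | P i) i <= k.
Proof.
move=> Pk; have := mem_index_enum k.
(* As m is arbitrary, it need not be neutral for minn: the term at k cannot be
   split off by monoid laws. *)
elim: (index_enum _) => // i s IHs; rewrite inE big_cons.
case/predU1P=> [<-|/IHs le_k]; first by rewrite Pk geq_minl.
by case: ifP => // _; rewrite geq_min le_k orbT.
Qed.

(** Removing the loops of a walk leaves a path that is no longer; its vertices
    being distinct, its length lies in the range of the minimum that defines
    [dist]. *)
Lemma dist_leq_walk x p : path e x p -> dist e x (last x p) <= size p.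
Proof.
case/shortenP=> q xq uq sub_qp.
have lt_q : size q < #|T|.
  by rewrite -[_.+1]/(size (x :: q)) -(card_uniqP uq) max_card.
have uniq_q : uniq q by case/andP: uq.
apply: leq_trans (uniq_leq_size uniq_q sub_qp).
apply: (@bigmin_leq _ _ (fun k => has_path e k x (last x q)) (Ordinal lt_q)).
by apply/existsP; exists (in_tuple q); rewrite /= xq eqxx andbT.
Qed.

Lemma setT_dominating : connected e -> 1 < #|T| ->
  total_mixed_dominating [set: element e].
Proof.
move=> conn /card_gt1P[x1 [x2 [_ _ x12]]]; apply/forallP=> -[x|A].
  have [y xy] : exists y, x != y.
    by case: (eqVneq x x1) => [->|]; [exists x2 | exists x1].
  case/connectP: (conn x y) => [[|z p]] /= => [_ yx|/andP[exz _] _].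
    by rewrite yx eqxx in xy.
  by apply/exists_inP; exists (inl z); rewrite ?inE.
have [u uA] := edge_inhabited A.
by apply/exists_inP; exists (inl u); rewrite ?inE.
Qed.

End Graph.

Theorem theorem2p7 (T : finType) (e : rel T)
    (e_sym : symmetric e) (e_irr : irreflexive e)
    (e_conn : connected e) (order_ge2 : 2 <= #|T|) :
  gamma_tm e = 2 -> diam e <= 3.
Proof.
rewrite /gamma_tm; case: arg_minnP => [|S domS _]; first exact: setT_dominating.
move/eqP/cards2P=> [a [b [_ defS]]]; rewrite {S}defS in domS.
have ab : adj_or_inc a b.
  have /exists_inP[c] := forallP domS a.
  by rewrite !inE => /orP[] /eqP-> //; rewrite adj_or_inc_irr.
have [u [v uv]] := dominating_pair_hub _ _ e_sym _ _ ab domS.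
apply/bigmax_leqP=> x _; apply/bigmax_leqP=> y _.
have [p [xp <- sp]] := hub_walk _ _ e_sym _ _ x y uv.
exact: leq_trans (dist_leq_walk _ _ _ _ xp) sp.
Qed.
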